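(* Let $\mathbb{X},\mathbb{U},\mathbb{V}$ be real Hilbert spaces, $f\in\mathbb{V}^*$, $b(\cdot,\cdot)\in\mathcal{L}(\mathbb{U}\times\mathbb{V};\mathbb{R})$ a continuous bilinear form, and let $\mathbb{U}_h\subset\mathbb{U}$, $\mathbb{V}_h\subset\mathbb{V}$ be finite-dimensional subspaces with $\dim(\mathbb{V}_h)>\dim(\mathbb{U}_h)$ and such that there is $\beta_h>0$ with $$\inf_{w_h\in\mathbb{U}_h}\sup_{v_h\in\mathbb{V}_h}\frac{b(w_h,v_h)}{\|w_h\|_{\mathbb{U}}\|v_h\|_{\mathbb{V}}}\ge\beta_h.$$ Consider a parametrized set of equivalent inner products $\{(\cdot,\cdot)_{\mathbb{V},\xi}\in\mathcal{L}(\mathbb{V}\times\mathbb{V};\mathbb{R}):\xi\in\mathbb{X}\}$ on $\mathbb{V}$, whose induced norms $\|\cdot\|_{\mathbb{V},\xi}$ satisfy, for some $C_{1,\xi},C_{2,\xi}>0$, $$C_{1,\xi}\|v\|_{\mathbb{V}}\le\|v\|_{\mathbb{V},\xi}\le C_{2,\xi}\|v\|_{\mathbb{V}}\qquad\forall v\in\mathbb{V}.$$ Let $A:\mathbb{X}\to\mathcal{L}(\mathbb{V},\mathbb{V}^* )$ be defined by $A(\xi)v:=(v,\cdot)_{\mathbb{V},\xi}\in\mathbb{V}^*$ for all $\xi\in\mathbb{X}$, $v\in\mathbb{V}$. For $\xi\in\mathbb{X}$ consider the mixed discrete problem: find $r_h\in\mathbb{V}_h$ and $u_h\equiv S_h(\xi)\in\mathbb{U}_h$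 such that $$(r_h,v_h)_{\mathbb{V},\xi}+b(u_h,v_h)=f(v_h)\ \ \forall v_h\in\mathbb{V}_h,\qquad b(w_h,r_h)=0\ \ \forall w_h\in\mathbb{U}_h.$$ Then: (i) The mixed discrete problem is well-posed. (ii) If there exist uniform constants $\tilde C_1>0$ and $\tilde C_2>0$ such that $C_{1,\xi}\ge\tilde C_1$ and $C_{2,\xi}\le\tilde C_2$ for all $\xi\in\mathbb{X}$, then the solution component $u_h\equiv S_h(\cdot)$ is uniformly bounded on $\mathbb{X}$. (iii) Additionally (under the hypotheses of (ii)), if $A(\cdot)$ is differentiable, then $S_h(\cdot)$ is also differentiable. Moreover, if $A'(\cdot)$ is uniformly bounded and Lipschitz continuous, then also $S_h'(\cdot)$ is uniformly bounded and Lipschitz continuous.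
   Context: The component $u_h$ of the mixed discrete problem is, equivalently (a known fact), the minimizer over $w_h\in\mathbb{U}_h$ of the discrete-dual residual norm $\sup_{v_h\in\mathbb{V}_h}|f(v_h)-b(w_h,v_h)|/\|v_h\|_{\mathbb{V},\xi}$. Well-posed means: for every $\xi\in\mathbb{X}$ and every $f\in\mathbb{V}^*$ there is a unique solution, depending continuously on $f$. Differentiability is in the Gâteaux sense: a map $G$ from $\mathbb{X}$ to a Banach space is differentiable at $\xi$ if for every $\eta\in\mathbb{X}$ the limit $G'(\xi)\eta=\lim_{t\to0}(G(\xi+t\eta)-G(\xi))/t$ exists and $\eta\mapsto G'(\xi)\eta$ is linear and continuous. Boundedness and Lipschitz continuity of $A'$ and $S_h'$ refer to the operator norms of $\mathcal{L}(\mathbb{X},\mathcal{L}(\mathbb{V},\mathbb{V}^* ))$ and $\mathcal{L}(\mathbb{X},\mathbb{U}_h)$, respectively. Infima and suprema of quotients are over nonzero elements. *)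

(* Defs.v *)
From HB Require Import structures.
From mathcomp Require Import all_boot all_order all_algebra.
From mathcomp Require Import all_classical all_reals all_analysis.

Set Implicit Arguments.
Unset Strict Implicit.
Unset Printing Implicit Defensive.

Import Order.TTheory GRing.Theory Num.Theory.
Import numFieldNormedType.Exports.

Local Open Scope classical_set_scope.
Local Open Scope ring_scope.

HB.mixin Record isHilbert (R : realType) H & CompleteNormedModule R H := {
  inner : {dot H for idfun} ;
  inner_norm : forall x : H, `|x| ^+ 2 = inner x x
}.

#[short(type="hilbertType")]
HB.structure Definition Hilbert (R : realType) :=
  {H of CompleteNormedModule R H & isHilbert R H}.

Section ContinuousLinear.
Variables (R : realType) (E F : normedModType R).

Definition contlinear : {pred E -> F} :=
  [pred f : E -> F | `[< linear f /\ continuous f >]].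

Lemma contlinearP (f : E -> F) :
  reflect (linear f /\ continuous f) (f \in contlinear).
Proof. exact: asboolP. Qed.

Lemma contlinear_submod : submod_closed contlinear.
Proof.
split.
  apply/contlinearP; split; first by move=> k x y; rewrite scaler0 addr0.
  by move=> x; apply: cvg_cst.
move=> k f g /contlinearP[lf cf] /contlinearP[lg cg]; apply/contlinearP; split.
  move=> c x y; rewrite !addrfctE !scalrfctE lf lg.
  by rewrite !scalerDr !scalerA (mulrC k c) addrACA.
by move=> x; apply: cvgD; [apply: cvgZl_tmp; exact: cf|exact: cg].
Qed.

HB.instance Definition _ :=
  GRing.isSubmodClosed.Build R (E -> F) contlinear contlinear_submod.

Record clinmap := CLinMap { clin_fun :> E -> F; _ : clin_fun \in contlinear }.

HB.instance Definition _ := [isSub for clin_fun].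
HB.instance Definition _ := [Choice of clinmap by <:].
HB.instance Definition _ := [SubChoice_isSubLmodule of clinmap by <:].

Lemma clin_linear (f : clinmap) : linear f.
Proof. by have /contlinearP[] := valP f. Qed.

HB.instance Definition _ (f : clinmap) :=
  GRing.isLinear.Build R E F *:%R f (@clin_linear f).

Lemma clin_continuous (f : clinmap) : continuous f.
Proof. by have /contlinearP[] := valP f. Qed.

Lemma clinD (f g : clinmap) x : (f + g) x = f x + g x.
Proof. by []. Qed.

Lemma clinZ k (f : clinmap) x : (k *: f) x = k *: f x.
Proof. by []. Qed.

Lemma clin0 x : (0 : clinmap) x = 0.
Proof. by []. Qed.

Lemma clinP (f g : clinmap) : f =1 g -> f = g.
Proof. by move=> fg; apply/val_inj/funext. Qed.

Definition quotients (f : E -> F) : set R :=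
  [set `|f x| / `|x| | x in [set x : E | x != 0]].

Definition opnorm (f : clinmap) : R := sup (quotients f).

Lemma clin_bounded (f : clinmap) :
  exists2 M, 0 <= M & forall x, `|f x| <= M * `|x|.
Proof.
have /linear_boundedP /pinfty_ex_gt0[M M0 fM] : bounded_near f (nbhs (0 : E)).
  exact/linear_bounded_continuous/clin_continuous.
by exists M => //; exact: ltW.
Qed.

Lemma quotients_ubound (f : clinmap) M :
  (forall x, `|f x| <= M * `|x|) -> ubound (quotients f) M.
Proof.
move=> fM _ [x /= x0 <-].
by rewrite ler_pdivrMr ?normr_gt0.
Qed.

Lemma has_ubound_quotients (f : clinmap) : has_ubound (quotients f).
Proof. by have [M _ fM] := clin_bounded f; exists M; exact: quotients_ubound. Qed.

Lemma ler_opnorm (f : clinmap) x : `|f x| <= opnorm f * `|x|.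
Proof.
have [->|x0] := eqVneq x 0; first by rewrite linear0 !normr0 mulr0.
rewrite -ler_pdivrMr ?normr_gt0//.
by apply: ub_le_sup; [exact: has_ubound_quotients|exists x].
Qed.

Lemma opnorm_le (f : clinmap) M :
  0 <= M -> (forall x, `|f x| <= M * `|x|) -> opnorm f <= M.
Proof.
move=> M0 fM; have [q0|/set0P q0] := eqVneq (quotients f) set0.
  by rewrite /opnorm q0 sup0.
exact/ge_sup/quotients_ubound.
Qed.

Lemma opnorm_ge0 (f : clinmap) : 0 <= opnorm f.
Proof.
have [q0|/set0P[q fq]] := eqVneq (quotients f) set0.
  by rewrite /opnorm q0 sup0.
apply: (le_trans _ (ub_le_sup (has_ubound_quotients f) fq)).
by case: fq => x _ <-; rewrite divr_ge0.
Qed.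

Lemma opnormD (f g : clinmap) : opnorm (f + g) <= opnorm f + opnorm g.
Proof.
apply: opnorm_le => [|x]; first by rewrite addr_ge0 ?opnorm_ge0.
by rewrite clinD mulrDl (le_trans (ler_normD _ _))// lerD ?ler_opnorm.
Qed.

Lemma opnormZ_le k (f : clinmap) : opnorm (k *: f) <= `|k| * opnorm f.
Proof.
apply: opnorm_le => [|x]; first by rewrite mulr_ge0 ?opnorm_ge0.
by rewrite clinZ normrZ -mulrA ler_wpM2l ?ler_opnorm.
Qed.

Lemma opnormZ k (f : clinmap) : opnorm (k *: f) = `|k| * opnorm f.
Proof.
apply/le_anti; rewrite opnormZ_le/=.
have [->|k0] := eqVneq k 0; first by rewrite normr0 mul0r opnorm_ge0.
rewrite -ler_pdivlMl ?normr_gt0// -normfV.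
by apply: le_trans (opnormZ_le _ _); rewrite scalerA mulVf// scale1r.
Qed.

Lemma opnorm0_eq0 (f : clinmap) : opnorm f = 0 -> f = 0.
Proof.
move=> f0; apply: clinP => x; rewrite clin0; apply/eqP.
by rewrite -normr_le0 (le_trans (ler_opnorm _ _))// f0 mul0r.
Qed.

HB.instance Definition _ :=
  Lmodule_isNormed.Build R clinmap opnormD opnormZ opnorm0_eq0.

Lemma clin_normE (f : clinmap) : `|f| = opnorm f.
Proof. by []. Qed.

End ContinuousLinear.

Notation "''L' ( E , F )" := (clinmap E F)
  (at level 8, format "''L' ( E ,  F )") : type_scope.

(* A linear subspace S of E, with the norm of E. *)
Section Subspace.
Variables (R : realType) (E : normedModType R) (S : submodClosed E).

Record subspace_of := Subspace { subspace_val : E; _ : subspace_val \in S }.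

HB.instance Definition _ := [isSub for subspace_val].
HB.instance Definition _ := [Choice of subspace_of by <:].
HB.instance Definition _ := [SubChoice_isSubLmodule of subspace_of by <:].

Let subspace_norm (x : subspace_of) : R := `|val x|.

Let subspace_normD x y :
  subspace_norm (x + y) <= subspace_norm x + subspace_norm y.
Proof. exact: ler_normD. Qed.

Let subspace_normZ k x : subspace_norm (k *: x) = `|k| * subspace_norm x.
Proof. exact: normrZ. Qed.

Let subspace_norm0_eq0 x : subspace_norm x = 0 -> x = 0.
Proof. by move=> /normr0_eq0 ?; apply: val_inj. Qed.

HB.instance Definition _ := Lmodule_isNormed.Build R subspace_of
  subspace_normD subspace_normZ subspace_norm0_eq0.

Lemma subspace_normE (x : subspace_of) : `|x| = `|val x|.
Proof. by []. Qed.

End Subspace.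

Definition has_dim (R : realType) (E : lmodType R) (n : nat) : Prop :=
  exists e : 'I_n -> E,
    (forall c : 'I_n -> R, \sum_i c i *: e i = 0 -> forall i, c i = 0) /\
    (forall x, exists c : 'I_n -> R, x = \sum_i c i *: e i).

Section Forms.
Variables (R : realType) (V : normedModType R).

Definition form_norm (a : {dot V for idfun}) (v : V) : R := Num.sqrt (a v v).

Variable a : {dot V for idfun}.
Hypothesis a_cont : continuous (fun p : V * V => a p.1 p.2).

Lemma form_bounded :
  exists2 k, 0 < k & forall u v, `|a u v| <= k * `|u| * `|v|.
Proof.
pose g : V -> V -> R^o := a.
have gl : bilinear_for *:%R *:%R g.
  by split => [u|u] k x y; [exact: linearPl|exact: linearPr].
pose g' := HB.pack_for {bilinear V -> V -> R^o} g
  (bilinear_isBilinear.Build R V V R^o *:%R *:%R g gl).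
exact: (@bilinear_schwarz _ _ _ _ g').
Qed.

Lemma form_contlinear v : (a v : V -> R^o) \in @contlinear R V R^o.
Proof.
have al : linear (a v : V -> R^o) by move=> k x y; exact: linearPr.
apply/contlinearP; split=> //.
have ac : continuous (fun x => (v, x) : V * V).
  by move=> x; apply: cvg_pair => /=; [exact: cvg_cst|exact: cvg_id].
by move=> x; apply: (@continuous_comp _ _ _ (fun x => (v, x) : V * V)
  (fun p => a p.1 p.2)); [exact: ac|exact: a_cont].
Qed.

Definition form_dual (v : V) : 'L(V, R^o) := CLinMap (form_contlinear v).

Lemma form_dual_contlinear : form_dual \in @contlinear R V 'L(V, R^o).
Proof.
have al : linear form_dual.
  by move=> k x y; apply: clinP => w; exact: linearPl.
apply/contlinearP; split=> //.
pose g := HB.pack_for {linear V -> 'L(V, R^o)} form_dual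
  (GRing.isLinear.Build R V 'L(V, R^o) *:%R form_dual al).
apply: (@bounded_linear_continuous _ _ _ g); apply/linear_boundedP.
have [k k0 ak] := form_bounded; near=> r => x.
apply: opnorm_le => [|y]; first by rewrite mulr_ge0.
apply: (le_trans (ak _ _)); rewrite !ler_wpM2r//.
Unshelve. all: by end_near. Qed.

Definition form_op : 'L(V, 'L(V, R^o)) := CLinMap form_dual_contlinear.

Lemma form_opE v w : form_op v w = a v w.
Proof. by []. Qed.

End Forms.

Section Gateaux.
Variables (R : realType) (X W : normedModType R).
Implicit Types (G : X -> W) (xi : X).

Definition gateaux_differentiable_at G xi : Prop :=
  (forall eta, derivable G xi eta) /\
  linear (fun eta => 'D_eta G xi) /\ continuous (fun eta => 'D_eta G xi).

Definition gateaux_differentiable G : Prop :=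
  forall xi, gateaux_differentiable_at G xi.

(* Meaningful when G is differentiable at xi; equal to 0 if eta |-> 'D_eta G xi
   is not linear and continuous. *)
Definition gateaux_derivative G xi : 'L(X, W) :=
  xget 0 [set D : 'L(X, W) | forall eta, D eta = 'D_eta G xi].

Lemma gateaux_derivativeE G xi eta :
  gateaux_differentiable_at G xi -> gateaux_derivative G xi eta = 'D_eta G xi.
Proof.
move=> [_ DG]; have /contlinearP DGP := DG.
have DG_ex : exists D : 'L(X, W), forall eta, D eta = 'D_eta G xi.
  by exists (CLinMap DGP).
exact: (xgetPex 0 DG_ex eta).
Qed.

End Gateaux.

Section MixedProblem.
Variables (R : realType) (U V : normedModType R).
Variables (b : {bilinear U -> V -> R^o}).
Variables (Uh : submodClosed U) (Vh : submodClosed V).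

(* Extended-real valued, so that the infimum over an empty set is +oo. *)
Definition infsup : \bar R :=
  ereal_inf [set ereal_sup
      [set (b (val w) (val v) / (`|w| * `|v|))%:E
        | v in [set v : subspace_of Vh | v != 0]]
    | w in [set w : subspace_of Uh | w != 0]].

Definition mixed_solution (a : {dot V for idfun}) (f : 'L(V, R^o))
    (ru : subspace_of Vh * subspace_of Uh) : Prop :=
  (forall v : subspace_of Vh,
     a (val ru.1) (val v) + b (val ru.2) (val v) = f (val v)) /\
  (forall w : subspace_of Uh, b (val w) (val ru.1) = 0).

Definition well_posed (a : {dot V for idfun}) : Prop :=
  (forall f : 'L(V, R^o), exists! ru, mixed_solution a f ru) /\
  (forall sol : 'L(V, R^o) -> subspace_of Vh * subspace_of Uh,
    (forall f, mixed_solution a f (sol f)) -> continuous sol).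

End MixedProblem.

(* Main.v *)
Require Import Defs.
From HB Require Import structures.
From mathcomp Require Import all_boot all_order all_algebra.
From mathcomp Require Import all_classical all_reals all_analysis.
From mathcomp Require Import ring.

Set Implicit Arguments.
Unset Strict Implicit.
Unset Printing Implicit Defensive.

Import Order.TTheory GRing.Theory Num.Theory.
Import numFieldNormedType.Exports.

Local Open Scope classical_set_scope.
Local Open Scope ring_scope.

(** Testing the mixed problem with v = r_h eliminates b and bounds r_h by the
    data; the inf-sup condition then bounds u_h. These bounds give uniqueness,
    hence existence in finite dimension, and they are uniform in xi as soon as
    C1 and C2 are. Subtracting the problems for two parameters shows that the
    difference of solutions solves a mixed problem whose right-hand side
    involves only A(xi) - A(zeta); applied to difference quotients this identifies
    S_h'(xi) eta as the second component of the mixed problem with right-hand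
    side - (A'(xi) eta) r_h(xi), and applied to these sensitivity problems it
    yields the Lipschitz bound, A itself being Lipschitz by the mean value
    inequality. *)

(** * Cauchy-Schwarz, coercivity and boundedness of inner products equivalent to the norm *)

Section DotForm.
Variables (R : realType) (V : normedModType R) (a : {dot V for idfun}).

Lemma dot_sym u v : a u v = a v u.
Proof. by rewrite hermC expr0 mul1r. Qed.

Lemma dotZl k u v : a (k *: u) v = k * a u v.
Proof. exact: linearZl_LR. Qed.

Lemma dotZr k u v : a u (k *: v) = k * a u v.
Proof. exact: linearZr_LR. Qed.

Lemma dotBl u v w : a (u - v) w = a u w - a v w.
Proof. exact: linearBl. Qed.

Lemma dotBr u v w : a u (v - w) = a u v - a u w.
Proof. exact: linearBr. Qed.

Lemma dot_ge0 v : 0 <= a v v.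
Proof.
by have [->|/neq0_dnorm_gt0/ltW//] := eqVneq v 0; rewrite linear0r.
Qed.

Lemma form_norm_sqr v : form_norm a v ^+ 2 = a v v.
Proof. by rewrite sqr_sqrtr ?dot_ge0. Qed.

(** Positivity of [a] on the diagonal at [a v v *: u - a u v *: v] expands to [a v v] times the
    difference of the squared sides; divide by [a v v > 0]. *)
Lemma dot_CauchySchwarz u v : `|a u v| <= form_norm a u * form_norm a v.
Proof.
have [->|v0] := eqVneq v 0.
  by rewrite linear0r normr0 mulr_ge0 ?sqrtr_ge0.
have vv : 0 < a v v by exact: neq0_dnorm_gt0.
rewrite -ler_sqr ?nnegrE ?mulr_ge0 ?sqrtr_ge0// exprMn !form_norm_sqr.
rewrite real_normK ?num_real//.
have := dot_ge0 (a v v *: u - a u v *: v).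
rewrite dotBl !dotBr !dotZl !dotZr (dot_sym v u) => h.
rewrite -subr_ge0 -(pmulr_rge0 _ vv); apply: le_trans h _.
by rewrite le_eqVlt; apply/orP; left; apply/eqP; ring.
Qed.

Variables (c1 c2 : R).
Hypothesis c1_gt0 : 0 < c1.
Hypothesis equiv : forall v,
  c1 * `|v| <= form_norm a v /\ form_norm a v <= c2 * `|v|.

Lemma dot_coercive v : c1 ^+ 2 * `|v| ^+ 2 <= a v v.
Proof.
rewrite -exprMn -form_norm_sqr ler_sqr ?nnegrE ?sqrtr_ge0//.
  by have [] := equiv v.
by rewrite mulr_ge0 ?(ltW c1_gt0).
Qed.

Lemma dot_bounded u v : `|a u v| <= c2 ^+ 2 * `|u| * `|v|.
Proof.
apply: le_trans (dot_CauchySchwarz u v) _.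
have [[_ eu] [_ ev]] := (equiv u, equiv v).
rewrite (_ : _ * `|v| = (c2 * `|u|) * (c2 * `|v|)); last by ring.
by rewrite ler_pM ?sqrtr_ge0.
Qed.

End DotForm.

(** * A priori bounds and linear combinations of solutions of mixed problems *)

Section Stability.
Variables (R : realType) (U V : normedModType R) (b : {bilinear U -> V -> R^o}).
Variables (Uh : submodClosed U) (Vh : submodClosed V).
Implicit Types (a : {dot V for idfun}) (f : 'L(V, R^o)).
Implicit Types (r v : subspace_of Vh) (u w : subspace_of Uh).

(** The infimum is at most the supremum attached to [w], which the bound on [b] keeps below
    [K / |w|]. The quotients are signed, so no absolute value is needed; [w = 0] is outside the
    infimum and is treated apart. *)
Lemma infsup_le beta w K : (beta%:E <= infsup b Uh Vh)%E -> 0 <= K ->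
  (forall v, b (val w) (val v) <= K * `|v|) -> beta * `|w| <= K.
Proof.
move=> bh K0 bK; have [->|w0] := eqVneq w 0; first by rewrite normr0 mulr0.
rewrite -ler_pdivlMr ?normr_gt0// -lee_fin; apply: le_trans bh _.
apply: ge_ereal_inf; eexists; first by exists w.
apply: ge_ereal_sup => _ [v /= v0 <-].
rewrite lee_fin ler_pdivrMr ?mulr_gt0 ?normr_gt0// mulrA divfK ?normr_eq0//.
exact: bK.
Qed.

(** Moving [(a1 - a2) (r2, .)] to the right-hand side turns a change of inner product into a change
    of data, so that stability for [a1] alone controls the difference. *)
Lemma mixed_solutionB a1 a2 (a1_cont : continuous (fun p : V * V => a1 p.1 p.2))
    (a2_cont : continuous (fun p : V * V => a2 p.1 p.2)) f1 f2 r1 r2 u1 u2 :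
  mixed_solution b a1 f1 (r1, u1) -> mixed_solution b a2 f2 (r2, u2) ->
  mixed_solution b a1
    (f1 - f2 - (form_op a1_cont - form_op a2_cont) (val r2))
    (r1 - r2, u1 - u2).
Proof.
move=> [/= e1 o1] [/= e2 o2]; split=> [v|w] /=; last first.
  by rewrite linearBr o1 o2 subrr.
rewrite !linearBl /= [RHS](_ : _ = f1 (val v) - f2 (val v) -
  (a1 (val r2) (val v) - a2 (val r2) (val v)))//.
by rewrite -e1 -e2; ring.
Qed.

Lemma mixed_solutionP a f1 f2 r1 r2 u1 u2 k :
  mixed_solution b a f1 (r1, u1) -> mixed_solution b a f2 (r2, u2) ->
  mixed_solution b a (k *: f1 + f2) (k *: r1 + r2, k *: u1 + u2).
Proof.
move=> [/= e1 o1] [/= e2 o2]; split=> [v|w] /=; last first.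
  by rewrite linearPr o1 o2 /= scaler0 addr0.
rewrite !linearPl /= [RHS](_ : _ = k * f1 (val v) + f2 (val v))//.
by rewrite -e1 -e2 /GRing.scale /=; ring.
Qed.

(** The constraint gives [b u r = 0], so testing with [r] leaves [a r r = f r]; coercivity bounds
    this below by [c1 ^+ 2 * |r| ^+ 2]. *)
Lemma mixed_residual_le a (c1 c2 : R) f r u : 0 < c1 ->
  (forall v : V, c1 * `|v| <= form_norm a v /\ form_norm a v <= c2 * `|v|) ->
  mixed_solution b a f (r, u) -> `|r| <= c1 ^- 2 * `|f|.
Proof.
move=> c1_gt0 equiv [/= e o]; rewrite ler_pdivlMl ?exprn_gt0//.
have [->|r0] := eqVneq r 0; first by rewrite normr0 mulr0.
rewrite -(ler_pM2r (x := `|r|)) ?normr_gt0// -mulrA -expr2.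
have := dot_coercive c1_gt0 equiv (val r).
move=> /le_trans; apply; have := e r; rewrite o addr0 => ->.
exact: le_trans (ler_norm _) (ler_opnorm _ _).
Qed.

(** The inf-sup bound is applied to [b u v = f v - a r v], which is at most
    [(|f| + c2 ^+ 2 * |r|) * |v|]; the residual bound removes [|r|]. *)
Lemma mixed_component_le a (c1 c2 beta : R) f r u : 0 < c1 ->
  0 < beta -> (beta%:E <= infsup b Uh Vh)%E ->
  (forall v : V, c1 * `|v| <= form_norm a v /\ form_norm a v <= c2 * `|v|) ->
  mixed_solution b a f (r, u) ->
  `|u| <= beta^-1 * (1 + c2 ^+ 2 * c1 ^- 2) * `|f|.
Proof.
move=> c1_gt0 beta_gt0 bh equiv sol.
have rf := mixed_residual_le c1_gt0 equiv sol; case: sol => /= e _.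
rewrite -mulrA ler_pdivlMl//; apply: infsup_le bh _ _ => [|v].
  by rewrite mulr_ge0// addr_ge0// mulr_ge0 ?invr_ge0 ?sqr_ge0.
have -> : b (val u) (val v) = f (val v) - a (val r) (val v) by rewrite -e; ring.
rewrite mulrDl mul1r mulrDl lerD ?(le_trans (ler_norm _) (ler_opnorm _ _))//.
rewrite (le_trans (ler_norm _))// normrN.
apply: le_trans (dot_bounded equiv _ _) _.
by rewrite ler_wpM2r// -[leRHS]mulrA ler_wpM2l ?sqr_ge0.
Qed.

End Stability.

(** The sum of the constants in the bounds for the residual and for [u], so that a single constant
    serves both. *)
Definition stability_constant (R : realType) (c1 c2 beta : R) : R :=
  c1 ^- 2 + beta^-1 * (1 + c2 ^+ 2 * c1 ^- 2).

Lemma stability_constant_gt0 (R : realType) (c1 c2 beta : R) :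
  0 < c1 -> 0 < beta -> 0 < stability_constant c1 c2 beta.
Proof.
move=> c1_gt0 beta_gt0; rewrite ltr_pwDl ?invr_gt0 ?exprn_gt0//.
apply: mulr_ge0; first by rewrite invr_ge0 ltW.
by rewrite addr_ge0// mulr_ge0 ?invr_ge0 ?sqr_ge0.
Qed.

(** * Existence, uniqueness and continuous dependence for a fixed inner product *)

Section WellPosed.
Variables (R : realType) (U V : normedModType R) (b : {bilinear U -> V -> R^o}).
Variables (Uh : submodClosed U) (Vh : submodClosed V).
Variable a : {dot V for idfun}.
Implicit Types f : 'L(V, R^o).
Implicit Types (r v : subspace_of Vh) (u w : subspace_of Uh).

(* In bases of Vh and Uh the problem is a square linear system, so existence
   follows from uniqueness. *)
Lemma mixed_solution_exists nU nV :
  has_dim (subspace_of Uh) nU -> has_dim (subspace_of Vh) nV ->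
  (forall r u, mixed_solution b a 0 (r, u) -> r = 0 /\ u = 0) ->
  forall f, exists ru : subspace_of Vh * subspace_of Uh,
    mixed_solution b a f ru.
Proof.
move=> [d [d_free d_span]] [e [e_free e_span]] inj f.
pose r (x : 'rV[R]_(nV + nU)) : subspace_of Vh :=
  \sum_i lsubmx x 0 i *: e i.
pose u (x : 'rV[R]_(nV + nU)) : subspace_of Uh :=
  \sum_i rsubmx x 0 i *: d i.
(* The saddle-point matrix, acting on row vectors: the first [nV] columns test the first equation on
   the basis [e], the last [nU] columns the constraint on [d]. *)
pose M : 'M[R]_(nV + nU) := block_mx
  (\matrix_(i, j) a (val (e i)) (val (e j)))
  (\matrix_(i, j) b (val (d j)) (val (e i)))
  (\matrix_(i, j) b (val (d i)) (val (e j))) 0.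
have ML x j : (x *m M) 0 (lshift nU j) =
    a (val (r x)) (val (e j)) + b (val (u x)) (val (e j)).
  rewrite -{1}[x]hsubmxK mul_row_block row_mxEl !mxE !raddf_sum /=.
  rewrite !linear_sumlz /=; congr (_ + _); apply: eq_bigr => i _.
    by rewrite [X in _ * X]mxE dotZl.
  by rewrite [X in _ * X]mxE linearZl_LR.
have MR x j : (x *m M) 0 (rshift nV j) = b (val (d j)) (val (r x)).
  rewrite -{1}[x]hsubmxK mul_row_block row_mxEr mulmx0 addr0 !mxE !raddf_sum /=.
  apply: eq_bigr => i _.
  by rewrite [X in _ * X]mxE linearZr_LR.
(* Both equations are linear in the test vector, so they need only be checked on the bases. *)
have solve (g : 'L(V, R^o)) x : x *m M = row_mx (\row_j g (val (e j))) 0 ->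
    mixed_solution b a g (r x, u x).
  move: (ML x) (MR x) => + + xM; rewrite xM; move: (r x) (u x) => rx ux La Lb.
  split=> [v|w].
    have [c ->] := e_span v; rewrite !raddf_sum -big_split /=.
    apply: eq_bigr => i _; rewrite !linearZr_LR linearZ /= -scalerDr.
    by congr (_ *: _); rewrite -La row_mxEl mxE.
  have [c ->] := d_span w; rewrite !raddf_sum /= linear_sumlz big1// => i _.
  by rewrite linearZl_LR -Lb row_mxEr mxE scaler0.
(* A kernel vector solves the problem with zero data, so [r x] and [u x] vanish, and by independence
   of the bases so do all coordinates. *)
have Mu : M \in unitmx.
  rewrite -row_free_unit; apply: inj_row_free => x xM.
  have [|rx ux] := inj (r x) (u x).
    apply: solve; rewrite xM -row_mx0; congr row_mx.
    by apply/rowP=> j; rewrite !mxE.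
  rewrite -[x]hsubmxK -row_mx0; congr row_mx; apply/rowP => i; rewrite [RHS]mxE.
    exact: (e_free (fun i => lsubmx x 0 i)).
  exact: (d_free (fun i => rsubmx x 0 i)).
exists (r (row_mx (\row_j f (val (e j))) 0 *m invmx M),
        u (row_mx (\row_j f (val (e j))) 0 *m invmx M)).
by apply: solve; rewrite mulmxKV.
Qed.

Variables (c1 c2 beta : R).
Hypotheses (c1_gt0 : 0 < c1) (beta_gt0 : 0 < beta).
Hypothesis a_cont : continuous (fun p : V * V => a p.1 p.2).
Hypothesis b_infsup : (beta%:E <= infsup b Uh Vh)%E.
Hypothesis equiv : forall v : V,
  c1 * `|v| <= form_norm a v /\ form_norm a v <= c2 * `|v|.

Local Notation K := (stability_constant c1 c2 beta).

Lemma mixed_solution_le f r u : mixed_solution b a f (r, u) ->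
  `|r| <= K * `|f| /\ `|u| <= K * `|f|.
Proof.
have k1 : 0 <= c1 ^- 2 by rewrite invr_ge0 sqr_ge0.
have k2 : 0 <= beta^-1 * (1 + c2 ^+ 2 * c1 ^- 2).
  apply: mulr_ge0; first by rewrite invr_ge0 ltW.
  by rewrite addr_ge0// mulr_ge0 ?sqr_ge0.
move=> s; split.
  apply: le_trans (mixed_residual_le c1_gt0 equiv s) _.
  by rewrite ler_wpM2r// lerDl.
apply: le_trans (mixed_component_le c1_gt0 beta_gt0 b_infsup equiv s) _.
by rewrite ler_wpM2r// lerDr.
Qed.

(** With equal inner products the correction term of [mixed_solutionB] vanishes, leaving the data
    [f1 - f2]. *)
Lemma mixed_solution_dist f1 f2 r1 r2 u1 u2 :
  mixed_solution b a f1 (r1, u1) -> mixed_solution b a f2 (r2, u2) ->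
  `|r1 - r2| <= K * `|f1 - f2| /\ `|u1 - u2| <= K * `|f1 - f2|.
Proof.
move=> s1 s2; have := mixed_solutionB a_cont a_cont s1 s2.
have -> : f1 - f2 - (form_op a_cont - form_op a_cont) (val r2) = f1 - f2.
  by rewrite subrr clin0 subr0.
exact: mixed_solution_le.
Qed.

Lemma mixed_solution_unique f r1 r2 u1 u2 :
  mixed_solution b a f (r1, u1) -> mixed_solution b a f (r2, u2) ->
  (r1, u1) = (r2, u2).
Proof.
move=> s1 s2; have [] := mixed_solution_dist s1 s2.
by rewrite subrr normr0 !mulr0 !normr_le0 !subr_eq0 => /eqP-> /eqP->.
Qed.

Lemma mixed_solution0 :
  mixed_solution b a 0 (0 : subspace_of Vh, 0 : subspace_of Uh).
Proof. by split=> [v|w] /=; rewrite ?linear0l ?linear0r ?addr0. Qed.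

Lemma mixed_well_posed nU nV :
  has_dim (subspace_of Uh) nU -> has_dim (subspace_of Vh) nV ->
  well_posed b Uh Vh a.
Proof.
move=> dU dV; split=> [f|sol solP].
  have [|[r u] s] := @mixed_solution_exists _ _ dU dV _ f.
    by move=> r u s; have [-> ->] := mixed_solution_unique s mixed_solution0.
  by exists (r, u); split=> // -[r' u'] /(mixed_solution_unique s).
have K0 := stability_constant_gt0 c2 c1_gt0 beta_gt0.
(* Any choice of solutions is Lipschitz in the data; the product norm is the maximum of the two
   component norms. *)
have solK f g : `|sol f - sol g| <= K * `|f - g|.
  have := solP f; have := solP g.
  case: (sol f) (sol g) => [r1 u1] [r2 u2] s2 s1.
  have [dr du] := mixed_solution_dist s1 s2.
  by rewrite prod_normE ge_max /= dr du.
move=> f; apply/(@cvgrPdist_le _ _ _ (nbhs f)) => eps eps_gt0.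
near=> g; rewrite (le_trans (solK _ _))// -ler_pdivlMl//.
near: g; apply: (@cvgr_dist_le _ _ _ (nbhs f) (nbhs_filter f) id f) => //.
by rewrite mulr_gt0 ?invr_gt0.
Unshelve. all: by end_near. Qed.

End WellPosed.

(** * Evaluation of operator-valued maps at a vector *)

Section Evaluation.
Variables (R : realType) (E F X : normedModType R).

Lemma clinB (f g : 'L(E, F)) v : (f - g) v = f v - g v.
Proof. by []. Qed.

Lemma clin_eval_continuous (v : E) : continuous (fun T : 'L(E, F) => T v).
Proof.
move=> T; apply/(@cvgrPdist_le _ _ _ (nbhs T)) => eps eps_gt0; near=> S.
rewrite (le_trans (ler_opnorm (T - S) v))//.
(* Adding 1 allows the division below also when [v = 0]. *)
have v_gt0 : 0 < `|v| + 1 by rewrite ltr_wpDl.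
rewrite (@le_trans _ _ (opnorm (T - S) * (`|v| + 1)))//.
  by rewrite ler_wpM2l ?opnorm_ge0// lerDl.
rewrite -ler_pdivlMr// -clin_normE.
near: S; apply: (@cvgr_dist_le _ _ _ (nbhs T) (nbhs_filter T) id T) => //.
by rewrite divr_gt0.
Unshelve. all: by end_near. Qed.

(** Evaluation is linear and continuous, so it passes through the limit of the difference
    quotients. *)
Lemma is_derive_eval (G : X -> 'L(E, F)) xi eta dG v :
  is_derive xi eta G dG -> is_derive xi eta (fun x => G x v) (dG v).
Proof.
move=> [G1 G2].
have Gv : h^-1 *: (((fun x => G x v) \o shift xi) (h *: eta) - G xi v)
    @[h --> 0^'] --> dG v.
  rewrite -G2; exact: (continuous_cvg _ (@clin_eval_continuous v _) G1).
by split; [apply/cvg_ex; exists (dG v)|exact: (cvg_lim _ Gv)].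
Qed.

End Evaluation.

(** Splits the difference of two sensitivity right-hand sides into the change of the operator and
    the change of the vector it acts on. *)
Lemma clin_apply2B (R : realType) (X E F : normedModType R)
    (f g : 'L(X, 'L(E, F))) x v w :
  - f x v - - g x w = - (f - g) x v - g x (v - w).
Proof.
by rewrite 2!clinB (linearB (g x)) opprK !opprB [RHS]addrC subrKA addrC.
Qed.

(** * Restriction to lines and the mean value inequality *)

Section MeanValue.
Variables (R : realType).

Lemma is_derive_line (X W : normedModType R) (G : X -> W) (x eta : X) (t : R) :
  derivable G (x + t *: eta) eta ->
  is_derive t (1 : R) (fun s : R => G (x + s *: eta)) ('D_eta G (x + t *: eta)).
Proof.
rewrite /derivable => dG.
have E : (fun h : R => h^-1 *: (((fun s : R => G (x + s *: eta)) \o shift t)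
    (h *: (1 : R)) - G (x + t *: eta))) =
  (fun h : R => h^-1 *: ((G \o shift (x + t *: eta)) (h *: eta)
    - G (x + t *: eta))).
  apply/funext => h /=; congr (_ *: (G _ - _)).
  by rewrite scalerDl -[h *: 1]/(h * 1) mulr1 addrCA.
by split; rewrite /derivable /derive E.
Qed.

Variables E F X : normedModType R.

(** Evaluating at [v] and [w] along the segment from [y] to [x] gives a real function, to which the
    mean value theorem on [[0, 1]] applies. The intermediate point depends on [v] and [w], but the
    bound [M] does not. *)
Lemma mean_value_inequality (A : X -> 'L(E, 'L(F, R^o))) M :
  gateaux_differentiable A -> (forall xi, `|gateaux_derivative A xi| <= M) ->
  forall x y, `|A x - A y| <= M * `|x - y|.
Proof.
move=> dA AM x y; have M0 : 0 <= M by exact: le_trans (AM x).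
apply: opnorm_le => [|v]; first by rewrite mulr_ge0.
apply: opnorm_le => [|w]; first by rewrite !mulr_ge0.
pose g (t : R) : R := A (y + t *: (x - y)) v w.
pose dg (t : R) : R := ('D_(x - y) A (y + t *: (x - y))) v w.
have g_dg (t : R) : is_derive t (1 : R) g (dg t).
  apply: (@is_derive_eval R F R^o R^o (fun s => A (y + s *: (x - y)) v)).
  apply: (@is_derive_eval R E 'L(F, R^o) R^o (fun s => A (y + s *: (x - y)))).
  by apply: is_derive_line; case: (dA (y + t *: (x - y))).
have [c _] := @MVT_segment R g dg 0 1 ler01 (fun t _ => g_dg t)
  (derivable_within_continuous (fun t _ => @ex_derive _ _ _ _ _ _ _ (g_dg t))).
rewrite subr0 mulr1 /g /dg scale0r addr0 scale1r subrKC.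
rewrite -gateaux_derivativeE// => Exy.
rewrite !clinB Exy; set D := gateaux_derivative A _.
apply: le_trans (ler_opnorm (D (x - y) v) w) _; rewrite ler_wpM2r//.
apply: le_trans (ler_opnorm (D (x - y)) v) _; rewrite ler_wpM2r//.
by apply: le_trans (ler_opnorm D (x - y)) _; rewrite ler_wpM2r// AM.
Qed.

End MeanValue.

(** * Dependence of the solution on the parameter, under uniform equivalence constants *)

Section Sensitivity.
Variables (R : realType) (X U V : normedModType R) (f : 'L(V, R^o)).
Variables (b : {bilinear U -> V -> R^o}).
Variables (Uh : submodClosed U) (Vh : submodClosed V).
Variables (nU nV : nat).
Hypotheses (dimUh : has_dim (subspace_of Uh) nU)
  (dimVh : has_dim (subspace_of Vh) nV).
Variables (c1 c2 beta : R).
Hypotheses (c1_gt0 : 0 < c1) (beta_gt0 : 0 < beta).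
Hypothesis b_infsup : (beta%:E <= infsup b Uh Vh)%E.
Variable ip : X -> {dot V for idfun}.
Hypothesis ip_cont : forall xi, continuous (fun p : V * V => ip xi p.1 p.2).
Hypothesis ip_equiv : forall xi v,
  c1 * `|v| <= form_norm (ip xi) v /\ form_norm (ip xi) v <= c2 * `|v|.
Variables (r : X -> subspace_of Vh) (S : X -> subspace_of Uh).
Hypothesis solP : forall xi, mixed_solution b (ip xi) f (r xi, S xi).

Let A xi : 'L(V, 'L(V, R^o)) := form_op (@ip_cont xi).
Local Notation K := (stability_constant c1 c2 beta).

Let K_ge0 : 0 <= K.
Proof. exact/ltW/stability_constant_gt0. Qed.

Let ip_le xi g r' (u' : subspace_of Uh) :
  mixed_solution b (ip xi) g (r', u') ->
  `|r' : subspace_of Vh| <= K * `|g| /\ `|u'| <= K * `|g|.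
Proof. exact: mixed_solution_le. Qed.

Lemma mixed_state_bounded xi : `|S xi| <= K * `|f|.
Proof. by have [] := ip_le (solP xi). Qed.

Lemma mixed_residual_bounded xi : `|r xi| <= K * `|f|.
Proof. by have [] := ip_le (solP xi). Qed.

(** The load [f] cancels in [mixed_solutionB], so the data of the difference are [A xi - A zeta]
    applied to the bounded residual [r zeta]. *)
Lemma mixed_residual_dist xi zeta :
  `|r xi - r zeta| <= K * (`|A xi - A zeta| * (K * `|f|)).
Proof.
have [+ _] := ip_le (mixed_solutionB (@ip_cont xi) (@ip_cont zeta)
  (solP xi) (solP zeta)).
move=> /le_trans; apply; rewrite ler_wpM2l// subrr sub0r normrN.
apply: le_trans (ler_opnorm (A xi - A zeta) (val (r zeta))) _.
by rewrite ler_wpM2l ?opnorm_ge0// mixed_residual_bounded.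
Qed.

(** The difference quotient of the solution solves a mixed problem at the moving parameter
    [h *: eta + xi]. Comparing it there with [(r', u')] gives an error that tends to 0, because the
    stability constant does not depend on the parameter. *)
Lemma mixed_solution_derive xi eta (r' : subspace_of Vh) (u' : subspace_of Uh) :
  derivable A xi eta ->
  mixed_solution b (ip xi) (- 'D_eta A xi (val (r xi))) (r', u') ->
  is_derive xi eta S u'.
Proof.
move=> dA s'.
pose dq (h : R) := h^-1 *: (A (h *: eta + xi) - A xi).
have dq_cvg : dq h @[h --> 0^'] --> 'D_eta A xi by exact: dA.
have dS_le : \forall h \near 0^', `|u' - h^-1 *: (S (h *: eta + xi) - S xi)| <=
    K * (`|'D_eta A xi - dq h| * `|r xi| + `|h| * `|dq h| * `|r'|).
  near=> h.
  have h0 : h != 0 by near: h; exact: nbhs_dnbhs_neq.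
  have s1 := mixed_solutionB (@ip_cont (h *: eta + xi)) (@ip_cont xi)
    (solP (h *: eta + xi)) (solP xi).
  (* Adding the zero solution turns the linear combination into a mere scaling by [h^-1]. *)
  have s2 := mixed_solutionP h^-1 s1 (mixed_solution0 _ _ _ _).
  rewrite !addr0 subrr sub0r in s2.
  have [_] := ip_le (mixed_solutionB (@ip_cont (h *: eta + xi)) (@ip_cont xi)
    s2 s').
  rewrite distrC => /le_trans; apply; rewrite ler_wpM2l//.
  rewrite (_ : h^-1 *: _ = - dq h (val (r xi))); last by rewrite scalerN.
  have -> : form_op (@ip_cont (h *: eta + xi)) - form_op (@ip_cont xi) =
      h *: dq h.
    by rewrite scalerA divff// scale1r.
  rewrite opprK [X in X - _]addrC -clinB (le_trans (ler_normB _ _))// lerD//.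
    exact: ler_opnorm.
  rewrite -normrZ; exact: ler_opnorm.
(* In the limit the first term vanishes since [dq] converges to the derivative of [A], the second
   through its factor [|h|]. *)
have B_cvg : K * (`|'D_eta A xi - dq h| * `|r xi| + `|h| * `|dq h| * `|r'|)
    @[h --> 0^'] --> K * (`|'D_eta A xi - 'D_eta A xi| * `|r xi|
      + `|0 : R| * `|'D_eta A xi| * `|r'|).
  apply: cvgM; first exact: cvg_cst.
  have h_cvg : (h : R) @[h --> 0^'] --> (0 : R) by exact: cvg_within.
  apply: cvgD; apply: cvgM; try exact: cvg_cst.
    exact: cvg_norm (cvgB (cvg_cst _) dq_cvg).
  by apply: cvgM; [exact: cvg_norm h_cvg|exact: cvg_norm dq_cvg].
rewrite subrr !normr0 !mul0r addr0 mulr0 in B_cvg.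
have dS_cvg : h^-1 *: ((S \o shift xi) (h *: eta) - S xi) @[h --> 0^'] --> u'.
  apply/subr_cvg0.
  apply: (@norm_cvg0 _ _ _ _ (dnbhs_filter _)).
  apply: (@squeeze_cvgr _ _ (dnbhs_filter _) _ (cst 0) _ _ _ 0
    (cvg_cst _) B_cvg).
  near=> h; rewrite normr_ge0 distrC /=; near: h; exact: dS_le.
by split; [apply/cvg_ex; exists u'|exact: (cvg_lim _ dS_cvg)].
Unshelve. all: by end_near. Qed.

Lemma mixed_sensitivity_exists xi eta :
  exists ru : subspace_of Vh * subspace_of Uh,
    mixed_solution b (ip xi) (- 'D_eta A xi (val (r xi))) ru.
Proof.
have [/(_ (- 'D_eta A xi (val (r xi))))[ru [? _]] _] :=
  mixed_well_posed c1_gt0 beta_gt0 (@ip_cont xi) b_infsup (ip_equiv xi)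
  dimUh dimVh.
by exists ru.
Qed.

Lemma sensitivity_rhs_le (T : 'L(X, 'L(V, 'L(V, R^o)))) xi eta :
  `|- T eta (val (r xi))| <= `|T| * `|eta| * (K * `|f|).
Proof.
rewrite normrN; apply: le_trans (ler_opnorm (T eta) (val (r xi))) _.
apply: ler_pM; rewrite ?opnorm_ge0//; first exact: (ler_opnorm T eta).
exact: mixed_residual_bounded.
Qed.

(** The sensitivity right-hand side is linear in [eta], so uniqueness makes the derivative linear;
    stability makes it bounded, hence continuous. *)
Lemma mixed_solution_gateaux xi : gateaux_differentiable_at A xi ->
  gateaux_differentiable_at S xi.
Proof.
move=> dA; have [dAxi [linA _]] := dA.
have [ru ruP] := choice (mixed_sensitivity_exists xi).
have dS eta : is_derive xi eta S (ru eta).2.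
  apply: (@mixed_solution_derive _ _ (ru eta).1) => //.
  by rewrite -surjective_pairing.
have linS : linear (fun eta => 'D_eta S xi).
  move=> k x y; rewrite !derive_val.
  have := ruP (k *: x + y); have := ruP x; have := ruP y.
  rewrite linA clinD clinZ opprD -scalerN.
  case: (ru x) (ru y) (ru _) => [rx ux] [ry uy] [rz uz] sy sx sz.
  by have [_ ->] := mixed_solution_unique c1_gt0 beta_gt0 (@ip_cont xi) b_infsup
    (@ip_equiv xi) sz (mixed_solutionP k sx sy).
split; first by move=> eta; exact: ex_derive.
split=> //.
pose g := HB.pack_for {linear X -> subspace_of Uh} (fun eta => 'D_eta S xi)
  (GRing.isLinear.Build R X (subspace_of Uh) *:%R (fun eta => 'D_eta S xi) linS).
apply: (@bounded_linear_continuous _ _ _ g); apply/linear_boundedP.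
near=> M => eta; rewrite /g /= derive_val.
have := ruP eta; rewrite [ru eta]surjective_pairing.
rewrite -(gateaux_derivativeE eta dA) => /ip_le[_ /le_trans]; apply.
apply: le_trans (ler_wpM2l K_ge0 (sensitivity_rhs_le _ _ _)) _.
rewrite [leLHS](_ : _ =
  K * `|gateaux_derivative A xi| * (K * `|f|) * `|eta|); last by ring.
by rewrite ler_wpM2r.
Unshelve. all: by end_near. Qed.

(** Presents the derivative as the component of a mixed solution, the form to which stability and
    [mixed_solutionB] apply. *)
Lemma gateaux_derivative_mixed xi eta :
  gateaux_differentiable_at A xi ->
  exists r' : subspace_of Vh, mixed_solution b (ip xi)
    (- gateaux_derivative A xi eta (val (r xi)))
    (r', gateaux_derivative S xi eta).
Proof.
move=> dA; have [[r' u'] s] := mixed_sensitivity_exists xi eta.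
exists r'; rewrite !gateaux_derivativeE//; last exact: mixed_solution_gateaux.
have [dAxi _] := dA.
by have /@derive_val -> := mixed_solution_derive (dAxi eta) s.
Qed.

Lemma gateaux_derivative_mixed_le xi : gateaux_differentiable_at A xi ->
  `|gateaux_derivative S xi| <= K * (`|gateaux_derivative A xi| * (K * `|f|)).
Proof.
move=> dA; apply: opnorm_le => [|eta]; first by rewrite !mulr_ge0.
have [r' /ip_le[_ /le_trans]] := gateaux_derivative_mixed eta dA; apply.
apply: le_trans (ler_wpM2l K_ge0 (sensitivity_rhs_le _ _ _)) _.
by rewrite le_eqVlt; apply/orP; left; apply/eqP; ring.
Qed.

(** Subtracting the sensitivity problems leaves three data terms: the change of [A'] ([T1]), of the
    residual ([T2]) and of the inner product ([T3]). The first contributes [K ^+ 2 * |f| * L], each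
    of the others [K ^+ 3 * M ^+ 2 * |f|], whence the factor 2. *)
Lemma gateaux_derivative_mixed_dist M L : 0 <= L ->
  gateaux_differentiable A ->
  (forall xi, `|gateaux_derivative A xi| <= M) ->
  (forall xi zeta, `|gateaux_derivative A xi - gateaux_derivative A zeta| <=
    L * `|xi - zeta|) ->
  forall xi zeta, `|gateaux_derivative S xi - gateaux_derivative S zeta| <=
    (K ^+ 2 * `|f| * L + 2 * K ^+ 3 * M ^+ 2 * `|f|) * `|xi - zeta|.
Proof.
move=> L0 dA AM AL xi zeta; have M0 : 0 <= M by exact: le_trans (AM xi).
apply: opnorm_le => [|eta].
  by rewrite mulr_ge0// addr_ge0// !mulr_ge0// exprn_ge0.
have [r1 s1] := gateaux_derivative_mixed eta (dA xi).
have [r2 s2] := gateaux_derivative_mixed eta (dA zeta).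
have [_] := ip_le (mixed_solutionB (@ip_cont xi) (@ip_cont zeta) s1 s2).
have r2_le : `|r2| <= K * (M * `|eta| * (K * `|f|)).
  have [/le_trans + _] := ip_le s2; apply; rewrite ler_wpM2l//.
  apply: le_trans (sensitivity_rhs_le _ _ _) _.
  by rewrite !ler_wpM2r ?mulr_ge0 ?AM.
rewrite clinB => /le_trans; apply.
set D1 := gateaux_derivative A xi; set D2 := gateaux_derivative A zeta.
rewrite (clin_apply2B D1 D2 eta (val (r xi)) (val (r zeta))).
have AM' : `|A xi - A zeta| <= M * `|xi - zeta| by exact: mean_value_inequality.
have T1 : `|- (D1 - D2) eta (val (r xi))| <=
    L * `|xi - zeta| * `|eta| * (K * `|f|).
  apply: le_trans (sensitivity_rhs_le _ _ _) _.
  by rewrite !ler_wpM2r ?mulr_ge0 ?AL.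
have T2 : `|D2 eta (val (r xi) - val (r zeta))| <=
    M * `|eta| * (K * (M * `|xi - zeta| * (K * `|f|))).
  apply: le_trans (ler_opnorm (D2 eta) _) _.
  apply: ler_pM; rewrite ?opnorm_ge0//.
    by apply: le_trans (ler_opnorm D2 eta) _; rewrite ler_wpM2r// AM.
  apply: le_trans (mixed_residual_dist _ _) _.
  by rewrite ler_wpM2l// ler_wpM2r ?mulr_ge0.
have T3 : `|(A xi - A zeta) (val r2)| <=
    M * `|xi - zeta| * (K * (M * `|eta| * (K * `|f|))).
  apply: le_trans (ler_opnorm (A xi - A zeta) _) _.
  by apply: ler_pM; rewrite ?opnorm_ge0.
apply: le_trans (ler_wpM2l K_ge0 (le_trans (ler_normB _ _)
  (lerD (le_trans (ler_normB _ _) (lerD T1 T2)) T3))) _.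
by rewrite le_eqVlt; apply/orP; left; apply/eqP; ring.
Qed.

End Sensitivity.

(** By the existence and uniqueness contained in well-posedness, exactly one map [Sh] meets the
    condition imposed on it. *)
Theorem proposition3p8 (R : realType) (X U V : hilbertType R)
    (f : 'L(V, R^o))
    (b : {bilinear U -> V -> R^o})
    (b_cont : continuous (fun p : U * V => b p.1 p.2))
    (Uh : submodClosed U) (Vh : submodClosed V) (nU nV : nat)
    (dimUh : has_dim (subspace_of Uh) nU)
    (dimVh : has_dim (subspace_of Vh) nV)
    (dim_lt : (nU < nV)%N)
    (beta : R) (beta_gt0 : 0 < beta)
    (b_infsup : (beta%:E <= infsup b Uh Vh)%E)
    (ip : X -> {dot V for idfun})
    (ip_cont : forall xi, continuous (fun p : V * V => ip xi p.1 p.2))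
    (C1 C2 : X -> R)
    (C1_gt0 : forall xi, 0 < C1 xi) (C2_gt0 : forall xi, 0 < C2 xi)
    (ip_equiv : forall xi v,
      C1 xi * `|v| <= form_norm (ip xi) v /\
      form_norm (ip xi) v <= C2 xi * `|v|) :
  let A : X -> 'L(V, 'L(V, R^o)) := fun xi => form_op (ip_cont xi) in
  (forall xi, well_posed b Uh Vh (ip xi)) /\
  (forall Sh : X -> subspace_of Uh,
    (forall xi, exists r : subspace_of Vh, mixed_solution b (ip xi) f (r, Sh xi)) ->
    (exists C1t C2t : R, [/\ 0 < C1t, 0 < C2t &
      forall xi, C1t <= C1 xi /\ C2 xi <= C2t]) ->
    bounded_fun Sh /\
    (gateaux_differentiable A ->
      gateaux_differentiable Sh /\
      (bounded_fun (gateaux_derivative A) ->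
       lipschitz (gateaux_derivative A) ->
       bounded_fun (gateaux_derivative Sh) /\
       lipschitz (gateaux_derivative Sh)))).
Proof.
move=> A; split=> [xi|S /choice[r solP] [c1 [c2 [c1_gt0 c2_gt0 cP]]]].
  (* For a fixed parameter its own constants [C1 xi] and [C2 xi] suffice. *)
  exact: (mixed_well_posed (C1_gt0 xi) beta_gt0 (@ip_cont xi) b_infsup
    (ip_equiv xi) dimUh dimVh).
have equiv xi v :
    c1 * `|v| <= form_norm (ip xi) v /\ form_norm (ip xi) v <= c2 * `|v|.
  have [[c1P c2P] [e1 e2]] := (cP xi, ip_equiv xi v).
  by rewrite (le_trans _ e1) ?ler_wpM2r// (le_trans e2)// ler_wpM2r.
pose K := stability_constant c1 c2 beta.
have K_ge0 : 0 <= K by exact/ltW/stability_constant_gt0.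
(* Boundedness on all of [X] is phrased through this filter, which is proper because [X] contains
   0. *)
have PX : ProperFilter (globally [set: X]).
  exact: (@globally_properfilter _ _ 0).
split.
  apply/(@ex_bound _ _ _ _ _ PX); exists (K * `|f|) => xi _.
  exact: (mixed_state_bounded c1_gt0 beta_gt0 b_infsup equiv solP).
move=> dA.
have dS : gateaux_differentiable S.
  move=> xi; exact: (mixed_solution_gateaux dimUh dimVh c1_gt0 beta_gt0 b_infsup
    (ip_cont := ip_cont) equiv solP (dA xi)).
split=> // /pinfty_ex_gt0[M M_gt0 AM] /pinfty_ex_gt0[L L_gt0 AL].
have {}AM xi : `|gateaux_derivative A xi| <= M by exact: (AM xi I).
have {}AL xi zeta : `|gateaux_derivative A xi - gateaux_derivative A zeta| <=
    L * `|xi - zeta|.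
  exact: (AL (xi, zeta) (conj I I)).
split.
  apply/(@ex_bound _ _ _ _ _ PX); exists (K * (M * (K * `|f|))) => xi _ /=.
  apply: le_trans (gateaux_derivative_mixed_le dimUh dimVh c1_gt0 beta_gt0
    b_infsup equiv solP (dA xi)) _.
  by rewrite ler_wpM2l// ler_wpM2r ?mulr_ge0.
(* The Lipschitz condition concerns pairs of parameters; the pair [(0, 0)] makes the corresponding
   filter proper. *)
apply: (@klipschitzW _ _ _ _ _ _
  (@globally_properfilter _ _ (0, 0) (conj I I))) => -[xi zeta] _ /=.
exact: (gateaux_derivative_mixed_dist dimUh dimVh c1_gt0 beta_gt0
  b_infsup equiv solP (ltW L_gt0) dA AM AL).
Qed.
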